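(* Let $Q$ be a Hausdorff, connected, locally path-connected space, let $G$ be a $Q$-group and $M$ be a $\hat\pi_0(G)$-module. The morphism $\eta^*_G:H^1(\hat{\pi}_0(G);M)\rightarrow H^1_Q(G;M_Q)$ is an isomorphism.
   Context: A $Q$-space is a Hausdorff, locally path-connected space $X$ with a continuous map $X\to Q$, written $x\mapsto \|x\|$. A $Q$-group is a group object in $Q$-spaces (continuous multiplication $m:G\times_Q G\to G$, unit $Q\to G$ and inverse $G\to G$ over $Q$, making every fibre a group). For a discrete group $D$, $D_Q$ denotes $D\times Q\to Q$ with fibrewise law. $G^k_Q$ is the $k$-fold fibre product of $G$ over $Q$ ($G^0_Q=Q$). The group $\hat\pi_0(G)$: for $c_1,c_2\in\pi_0(G)$ let $c_1\cdot c_2$ be the set of connected components of $G$ meeting $m(c_1\times_Q c_2)$; $\hat\pi_0(G)=\langle \pi_0(G)\mid c_1c_2c_3^{-1},\ c_3\in c_1\cdot c_2\rangle$. $\eta_G:G\to\hat\pi_0(G)$ sends $g$ to the class of its connected component. If $M$ is a $\hat\pi_0(G)$-module (a discrete abelian group), $M_Q=M\times Q$ is a $G$-module via $g\cdot(m;\|g\|)=(\eta_G(g)m;\|g\|)$. Cohomology: $C^k_Q(G;M_Q)$ is the group of continuous maps over $Q$, $\alpha:G^k_Q\to M_Q$, with differential $$d\alpha(g_1;\dots;g_{k+1})=g_1\cdot\alpha(g_2;\dots;g_{k+1})+\sum_{i=1}^k(-1)^i\alpha(g_1;\dots;g_ig_{i+1};\dots;g_{k+1})+(-1)^{k+1}\alpha(g_1;\dots;g_k)$$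 (in degree $0$, a cochain is a continuous section $\alpha$ of $M_Q\to Q$ and $d\alpha(g)=g\cdot\alpha(\|g\|)-\alpha(\|g\|)$), and $H^k_Q(G;M_Q)$ is its cohomology. $\eta_G^*$ is the map in cohomology induced by pulling back ordinary group cochains of $\hat\pi_0(G)$ with values in $M$ along $\eta_G$. *)

(* Defs.v *)
From HB Require Import structures.
From mathcomp Require Import all_boot all_order all_algebra.
From mathcomp Require Import all_classical all_reals all_analysis.
Import Order.TTheory GRing.Theory Num.Theory.
Import numFieldNormedType.Exports.

Set Implicit Arguments.
Unset Strict Implicit.
Unset Printing Implicit Defensive.

Local Open Scope classical_set_scope.
Local Open Scope ring_scope.
Local Open Scope quotient_scope.

Definition path_connected (R : realType) (X : topologicalType) (A : set X) :=
  forall x y, A x -> A y -> exists f : R -> X,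
    [/\ {within `[0, 1], continuous f}, f 0 = x, f 1 = y
      & f @` `[0, 1] `<=` A].

Definition locally_path_connected (R : realType) (X : topologicalType) :=
  forall (x : X) (U : set X), nbhs x U ->
    exists V : set X, [/\ open V, V x, V `<=` U & path_connected R V].

Lemma path_connected_connected (R : realType) (X : topologicalType)
  (A : set X) (x : X) : A x -> path_connected R A ->
  A `<=` connected_component [set: X] x.
Proof.
move=> Ax pA y Ay; have [f [fc f0 f1 fA]] := pA x y Ax Ay.
exists (f @` `[0, 1]); last by exists 1 => //=; rewrite in_itv/= lexx ler01.
split=> //; first by exists 0 => //=; rewrite in_itv/= lexx ler01.
apply: connected_continuous_connected => //.
exact/connected_intervalP/interval_is_interval.
Qed.

Record Qspace (R : realType) (Q : topologicalType) := {
  Qcarrier :> topologicalType;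
  Qnorm : Qcarrier -> Q;
  Qspace_hausdorff : hausdorff_space Qcarrier;
  Qspace_lpc : locally_path_connected R Qcarrier;
  Qnorm_continuous : continuous Qnorm }.

(* The operations are total functions, but [Qmul g h] is only meaningful (and
   only constrained) when [g] and [h] lie in the same fibre: [Qmul_continuous]
   is the continuity of the multiplication on the fibre product [G x_Q G]. *)
Record Qgroup (R : realType) (Q : topologicalType) := {
  Qgroup_space :> Qspace R Q;
  Qmul : Qgroup_space -> Qgroup_space -> Qgroup_space;
  Qone : Q -> Qgroup_space;
  Qinv : Qgroup_space -> Qgroup_space;
  Qmul_norm : forall g h, Qnorm g = Qnorm h -> Qnorm (Qmul g h) = Qnorm g;
  Qone_norm : forall q, Qnorm (Qone q) = q;
  Qinv_norm : forall g, Qnorm (Qinv g) = Qnorm g;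
  Qmul_continuous :
    {within [set gh : Qgroup_space * Qgroup_space | Qnorm gh.1 = Qnorm gh.2],
      continuous (fun gh => Qmul gh.1 gh.2)};
  Qone_continuous : continuous Qone;
  Qinv_continuous : continuous Qinv;
  QmulA : forall g h k, Qnorm g = Qnorm h -> Qnorm h = Qnorm k ->
    Qmul g (Qmul h k) = Qmul (Qmul g h) k;
  Qmul1g : forall g, Qmul (Qone (Qnorm g)) g = g;
  Qmulg1 : forall g, Qmul g (Qone (Qnorm g)) = g;
  QmulVg : forall g, Qmul (Qinv g) g = Qone (Qnorm g);
  QmulgV : forall g, Qmul g (Qinv g) = Qone (Qnorm g) }.

Section Presentation.
Variables (X : choiceType) (rels : set (seq (X * bool))).

(* The letter [(x, true)] stands for x and [(x, false)] for its inverse. *)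
Definition word : Type := seq (X * bool).
HB.instance Definition _ := Choice.on word.

Inductive word_cong : word -> word -> Prop :=
| word_refl u : word_cong u u
| word_sym u v : word_cong u v -> word_cong v u
| word_trans u v w : word_cong u v -> word_cong v w -> word_cong u w
| word_cat u u' v v' :
    word_cong u u' -> word_cong v v' -> word_cong (u ++ v) (u' ++ v')
| word_cancel x b : word_cong [:: (x, b); (x, ~~ b)] [::]
| word_rel r : rels r -> word_cong r [::].

Definition word_eqv (u v : word) : bool := `[< word_cong u v >].

Lemma word_eqv_refl : reflexive word_eqv.
Proof. by move=> u; apply/asboolP/word_refl. Qed.
Lemma word_eqv_sym : symmetric word_eqv.
Proof. by move=> u v; apply: asbool_equiv_eq; split; apply: word_sym. Qed.
Lemma word_eqv_trans : transitive word_eqv.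
Proof. by move=> v u w /asboolP uv /asboolP vw; apply/asboolP/(word_trans uv). Qed.

Canonical word_equiv :=
  EquivRel word_eqv word_eqv_refl word_eqv_sym word_eqv_trans.

Definition presented := {eq_quot word_eqv}.
HB.instance Definition _ := Choice.on presented.
HB.instance Definition _ : EqQuotient word word_eqv presented :=
  EqQuotient.on presented.

Definition word_inv (u : word) : word := rev [seq (l.1, ~~ l.2) | l <- u].

Lemma word_invK : involutive word_inv.
Proof.
move=> u; rewrite /word_inv map_rev revK -map_comp map_id_in// => -[x b] _ /=.
by rewrite negbK.
Qed.

Lemma word_mulVr u : word_cong (u ++ word_inv u) [::].
Proof.
elim: u => [|[x b] u IH]; first exact: word_refl.
have -> : ((x, b) :: u) ++ word_inv ((x, b) :: u) =
          [:: (x, b)] ++ (u ++ word_inv u) ++ [:: (x, ~~ b)].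
  by rewrite /word_inv /= rev_cons -cats1 catA.
apply: word_trans (word_cancel x b); rewrite -[X in word_cong _ X]cat1s.
apply: word_cat; first exact: word_refl.
by rewrite -[X in word_cong _ X]cat0s; apply: word_cat (word_refl _).
Qed.

Lemma word_mulVl u : word_cong (word_inv u ++ u) [::].
Proof. by have := word_mulVr (word_inv u); rewrite word_invK. Qed.

Lemma presented_eqP (u v : word) :
  \pi_presented u = \pi_presented v <-> word_cong u v.
Proof. by split=> [/eqmodP/asboolP//|uv]; apply/eqmodP/asboolP. Qed.

Lemma word_cong_repr (u : word) : word_cong (repr (\pi_presented u)) u.
Proof. by apply/presented_eqP; rewrite reprK. Qed.

Definition pres_mul (a b : presented) : presented :=
  \pi_presented (repr a ++ repr b : word).
Definition pres_one : presented := \pi_presented ([::] : word).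
Definition pres_inv (a : presented) : presented :=
  \pi_presented (word_inv (repr a)).

Lemma pres_mulA : associative pres_mul.
Proof.
move=> a b c; apply/presented_eqP.
apply: (@word_trans _ (repr a ++ (repr b ++ repr c))).
  exact: word_cat (word_refl _) (word_cong_repr _).
by rewrite catA; apply/word_sym/word_cat/word_refl/word_cong_repr.
Qed.

Lemma pres_mul1 : left_id pres_one pres_mul.
Proof.
move=> a; rewrite -[RHS]reprK; apply/presented_eqP.
exact: word_cat (word_cong_repr [::]) (word_refl _).
Qed.

Lemma pres_1mul : right_id pres_one pres_mul.
Proof.
move=> a; rewrite -[RHS]reprK; apply/presented_eqP.
rewrite -[X in word_cong _ X]cats0.
exact: word_cat (word_refl _) (word_cong_repr [::]).
Qed.

Lemma pres_mulV : left_inverse pres_one pres_inv pres_mul.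
Proof.
move=> a; apply/presented_eqP; apply: word_trans (word_mulVl (repr a)).
exact: word_cat (word_cong_repr _) (word_refl _).
Qed.

Lemma pres_Vmul : right_inverse pres_one pres_inv pres_mul.
Proof.
move=> a; apply/presented_eqP; apply: word_trans (word_mulVr (repr a)).
exact: word_cat (word_refl _) (word_cong_repr _).
Qed.

HB.instance Definition _ := isGroup.Build presented
  pres_mulA pres_mul1 pres_1mul pres_mulV pres_Vmul.

Definition pres_gen (x : X) : presented := \pi_presented ([:: (x, true)] : word).

Lemma pres_genM (x y z : X) :
  rels [:: (x, true); (y, true); (z, false)] ->
  (pres_gen x * pres_gen y)%g = pres_gen z.
Proof.
move=> Rxyz; apply/presented_eqP.
apply: (@word_trans _ [:: (x, true); (y, true)]).
  exact: (word_cat (word_cong_repr [:: (x, true)]) (word_cong_repr [:: (y, true)])).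
apply: (@word_trans _ ([:: (x, true); (y, true); (z, false)] ++ [:: (z, true)])).
  exact/(word_cat (word_refl [:: (x, true); (y, true)]))/word_sym/word_cancel.
exact: word_cat (word_rel Rxyz) (word_refl _).
Qed.

End Presentation.

Definition pi0 (X : topologicalType) : Type :=
  range (connected_component [set: X]).
HB.instance Definition _ (X : topologicalType) := Choice.on (pi0 X).

Definition pi0_class (X : topologicalType) (x : X) : pi0 X :=
  exist _ (connected_component [set: X] x)
          (mem_set (imageT (connected_component [set: X]) x)).

Section HatPi0.
Variables (R : realType) (Q : topologicalType) (G : Qgroup R Q).

(* The image [m (A x_Q B)] of the part of [A * B] lying over the diagonal of [Q] *)
Definition Qmul_set (A B : set G) : set G :=
  [set k | exists g h, [/\ A g, B h, Qnorm g = Qnorm h & k = Qmul g h]].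

Definition pi0_mul (c1 c2 : pi0 G) : set (pi0 G) :=
  [set c3 | (val c3 `&` Qmul_set (val c1) (val c2)) !=set0].

Definition hat_pi0_relators : set (seq (pi0 G * bool)) :=
  [set r | exists c1 c2 c3, pi0_mul c1 c2 c3 /\
     r = [:: (c1, true); (c2, true); (c3, false)]].

Definition hat_pi0 : groupType := presented hat_pi0_relators.

Definition eta (g : G) : hat_pi0 := pres_gen hat_pi0_relators (pi0_class g).

Lemma etaM (g h : G) : Qnorm g = Qnorm h -> eta (Qmul g h) = (eta g * eta h)%g.
Proof.
move=> gh; apply/esym/pres_genM; exists (pi0_class g), (pi0_class h).
exists (pi0_class (Qmul g h)); split=> //; exists (Qmul g h); split.
  exact: connected_component_refl.
by exists g, h; split=> //; exact: connected_component_refl.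
Qed.

Lemma eta_locally_constant (g : G) : \forall h \near g, eta h = eta g.
Proof.
have [V [oV Vg _ pV]] := Qspace_lpc (@filterT _ (nbhs g) _).
apply: (filterS _ (open_nbhs_nbhs (conj oV Vg))) => h Vh; congr pres_gen.
apply: val_inj => /=; apply/esym/same_connected_component.
exact: path_connected_connected Vg pV _ Vh.
Qed.

End HatPi0.

Record gmodule (Gamma : groupType) := {
  gmodule_zmod :> zmodType;
  gact : Gamma -> {additive gmodule_zmod -> gmodule_zmod};
  gact1 : forall m, gact 1%g m = m;
  gactM : forall a b m, gact (a * b)%g m = gact a (gact b m) }.

(* [D_Q]; its projection to [Q] is [snd]. *)
Definition constQ (D : choiceType) (Q : topologicalType) : topologicalType :=
  (discrete_topology D * Q)%type.

Definition actQ (R : realType) (Q : topologicalType) (G : Qgroup R Q)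
  (M : gmodule (hat_pi0 G)) (g : G) (m : constQ M Q) : constQ M Q :=
  (gact M (eta g) m.1, Qnorm g).

Section Kernel.
Variables (A B : zmodType) (f : {additive A -> B}).

Definition in_ker : {pred A} := fun x => f x == 0.

Lemma in_ker_closed : zmod_closed in_ker.
Proof.
split=> [|x y]; rewrite !unfold_in /in_ker ?raddf0// raddfB.
by move=> /eqP-> /eqP->; rewrite subr0.
Qed.
HB.instance Definition _ := GRing.isZmodClosed.Build A in_ker in_ker_closed.

Record ker := Ker { ker_val :> A; ker_valP : ker_val \in in_ker }.
HB.instance Definition _ := [isSub for ker_val].
HB.instance Definition _ := [Choice of ker by <:].
HB.instance Definition _ := [SubChoice_isSubZmodule of ker by <:].

End Kernel.

(* [d \o d = 0] is not required: [coboundary] below consists of the cocycles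
   lying in the image of the previous differential, which is the whole image
   for a complex. *)
Record cochains := {
  cochain :> nat -> zmodType;
  codiff : forall k, {additive cochain k -> cochain k.+1} }.

Section Cohomology.
Variable C : cochains.

Definition cocycle (k : nat) : zmodType := ker (codiff C k).

Definition is_coboundary (k : nat) : C k -> Prop :=
  match k with
  | 0 => fun z => z = 0
  | k'.+1 => fun z => exists y : C k', z = codiff C k' y
  end.

Definition coboundary (k : nat) : {pred cocycle k} :=
  fun z => `[< is_coboundary (val z) >].

Lemma coboundary_closed k : zmod_closed (@coboundary k).
Proof.
case: k => [|k]; split=> [|x y]; rewrite !unfold_in /coboundary.
- exact/asboolP.
- by move=> /asboolP/= x0 /asboolP/= y0; apply/asboolP; rewrite /= x0 y0 subr0.
- by apply/asboolP; exists 0; rewrite raddf0.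
- move=> /asboolP/= [a xa] /asboolP/= [b yb]; apply/asboolP; exists (a - b).
  by rewrite raddfB /= xa yb.
Qed.
HB.instance Definition _ k :=
  GRing.isZmodClosed.Build (cocycle k) (@coboundary k) (coboundary_closed k).

Definition cohomology (k : nat) : zmodType := Quotient.quot (@coboundary k).

Definition cohomology_class k : cocycle k -> cohomology k :=
  \pi_(Quotient.quot (@coboundary k)).

End Cohomology.

Section InducedMap.
Variables (C D : cochains) (f : forall k, {additive C k -> D k}).
Hypothesis fd : forall k x, codiff D k (f k x) = f k.+1 (codiff C k x).

Lemma cocycle_map_subproof k (z : cocycle C k) :
  f k (val z) \in in_ker (codiff D k).
Proof.
have /eqP z0 := ker_valP z.
by rewrite unfold_in /in_ker fd z0 raddf0.
Qed.
Definition cocycle_map k (z : cocycle C k) : cocycle D k :=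
  Ker (cocycle_map_subproof z).

Lemma cocycle_map_coboundary k (z : cocycle C k) :
  z \in @coboundary C k -> cocycle_map z \in @coboundary D k.
Proof.
rewrite !unfold_in /coboundary /cocycle_map; case: k z => [|k] z /asboolP zb.
  by apply/asboolP; rewrite /= zb raddf0.
by have [y /= zy] := zb; apply/asboolP; exists (f k y); rewrite /= zy fd.
Qed.

Lemma cocycle_mapB k : {morph @cocycle_map k : x y / x - y}.
Proof. by move=> x y; apply: val_inj; rewrite /= raddfB. Qed.

Definition cohomology_map_fun k (c : cohomology C k) : cohomology D k :=
  cohomology_class (cocycle_map (repr c)).

Lemma cohomology_class_eqP (E : cochains) k (x y : cocycle E k) :
  cohomology_class x = cohomology_class y <-> x - y \in @coboundary E k.
Proof. by split=> [/eqP|xy]; [|apply/eqP; move: xy]; rewrite Quotient.idealrBE. Qed.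

Lemma cohomology_mapE k (z : cocycle C k) :
  cohomology_map_fun (cohomology_class z) = cohomology_class (cocycle_map z).
Proof.
apply/cohomology_class_eqP; rewrite -cocycle_mapB cocycle_map_coboundary//.
by apply/cohomology_class_eqP; rewrite /cohomology_class reprK.
Qed.

Lemma cohomology_map_additive k : zmod_morphism (@cohomology_map_fun k).
Proof.
move=> x y; rewrite -[x]reprK -[y]reprK -raddfB.
by rewrite !cohomology_mapE cocycle_mapB /cohomology_class raddfB.
Qed.
HB.instance Definition _ k := GRing.isZmodMorphism.Build _ _
  (@cohomology_map_fun k) (@cohomology_map_additive k).

Definition cohomology_map k : {additive cohomology C k -> cohomology D k} :=
  @cohomology_map_fun k.

End InducedMap.

(* Faces of the bar construction, for (k+1)-tuples indexed by 'I_k.+1: note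
   that [lift ord0 j] has value [j.+1] and [lift ord_max j] has value [j]. *)
Section BarFaces.
Variables (T : Type) (mul : T -> T -> T) (k : nat).

Definition face_first (g : 'I_k.+1 -> T) : 'I_k -> T :=
  fun j => g (lift ord0 j).

Definition face_last (g : 'I_k.+1 -> T) : 'I_k -> T :=
  fun j => g (lift ord_max j).

Definition face_mid (i : 'I_k) (g : 'I_k.+1 -> T) : 'I_k -> T :=
  fun j => if (j < i)%N then g (lift ord_max j)
           else if j == i then mul (g (lift ord_max i)) (g (lift ord0 i))
           else g (lift ord0 j).

End BarFaces.

Section GroupCohomology.
Variables (Gamma : groupType) (M : gmodule Gamma).

Definition gcochain (k : nat) : zmodType := ('I_k -> Gamma) -> M.

Definition gdiff_fun k (a : gcochain k) : gcochain k.+1 := fun g =>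
  gact M (g ord0) (a (face_first g))
  + \sum_(i < k) a (face_mid *%g i g) *~ (-1) ^+ i.+1
  + a (face_last g) *~ (-1) ^+ k.+1.

Lemma gdiff_additive k : zmod_morphism (@gdiff_fun k).
Proof.
move=> a b; apply/funext => g; rewrite /gdiff_fun !fctE raddfB mulrzBl.
rewrite (eq_bigr _ (fun i _ => mulrzBl _ _ _)) sumrB.
by rewrite !opprD [in RHS]addrACA (addrACA (gact M _ _)).
Qed.
HB.instance Definition _ k :=
  GRing.isZmodMorphism.Build _ _ (@gdiff_fun k) (@gdiff_additive k).

Definition gcochains : cochains :=
  {| cochain := gcochain; codiff := fun k => @gdiff_fun k |}.

End GroupCohomology.

Section FibrePower.
Variables (R : realType) (Q : topologicalType) (G : Qgroup R Q).

(* [G^k_Q], presented as the set of (q; g_1, ..., g_k) with all g_i in the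
   fibre over q, so that [G^0_Q = Q]. *)
Definition Qpower (k : nat) : topologicalType :=
  [set x : Q * {ptws 'I_k -> G} | forall i, Qnorm (x.2 i) = x.1].

Definition Qbase k (x : Qpower k) : Q := (val x).1.
Definition Qcoord k (x : Qpower k) : 'I_k -> G := (val x).2.

Lemma Qcoord_norm k (x : Qpower k) i : Qnorm (Qcoord x i) = Qbase x.
Proof. exact: set_valP x i. Qed.

Definition Qtuple k (q : Q) (g : 'I_k -> G) (gq : forall i, Qnorm (g i) = q) :
    Qpower k :=
  exist _ (q, g) (mem_set gq).

Lemma Qbase_continuous k : continuous (@Qbase k).
Proof.
move=> x; apply: (@continuous_comp (Qpower k) (Q * {ptws 'I_k -> G})%type Q
  set_val fst); first exact: initial_continuous.
exact: cvg_fst.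
Qed.

Lemma Qcoord_continuous k i : continuous (fun x : Qpower k => Qcoord x i).
Proof.
move=> x; apply: (@continuous_comp (Qpower k) {ptws 'I_k -> G} G
  (fun x => (val x).2) (fun g => g i)); last exact: (@proj_continuous _ (fun=> G)).
apply: (@continuous_comp (Qpower k) (Q * {ptws 'I_k -> G})%type {ptws 'I_k -> G}
  set_val snd); first exact: initial_continuous.
exact: cvg_snd.
Qed.

Lemma Qpower_continuous k (S : topologicalType) (f : S -> Qpower k) :
  continuous (fun s => Qbase (f s)) ->
  (forall i, continuous (fun s => Qcoord (f s) i)) -> continuous f.
Proof.
move=> fb fc; apply: continuous_comp_initial.
have fE : val \o f = fun s => (Qbase (f s), Qcoord (f s) : {ptws 'I_k -> G}).
  by apply/funext => t; rewrite /Qbase /Qcoord /= -surjective_pairing.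
have gc : continuous (fun s => Qcoord (f s) : {ptws 'I_k -> G}).
  move=> s; apply/cvg_sup => i U [_ [[W oW <-] Ws] /filterS]; apply.
  by apply: fc; exact: open_nbhs_nbhs.
rewrite [X in continuous X]fE => s.
exact: (cvg_pair (fb s) (gc s)).
Qed.

Lemma Qmul_comp_continuous (S : topologicalType) (u v : S -> G) :
  continuous u -> continuous v -> (forall s, Qnorm (u s) = Qnorm (v s)) ->
  continuous (fun s => Qmul (u s) (v s)).
Proof.
move=> uc vc uv; pose A := [set gh : G * G | Qnorm gh.1 = Qnorm gh.2].
pose w s : A := exist _ (u s, v s) (mem_set (uv s)).
have wc : continuous w.
  apply: (@continuous_comp_initial A S _ set_val) => s.
  exact: (cvg_pair (uc s) (vc s)).
have /subspace_sigL_continuousP mc := @Qmul_continuous R Q G.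
move=> s; exact: (@continuous_comp S A G w (sigL A (fun gh => Qmul gh.1 gh.2))
  s (wc s) (mc (w s))).
Qed.

Section Faces.
Variable k : nat.

Lemma Qface_first_subproof (x : Qpower k.+1) j :
  Qnorm (face_first (Qcoord x) j) = Qbase x.
Proof. exact: Qcoord_norm. Qed.

Lemma Qface_last_subproof (x : Qpower k.+1) j :
  Qnorm (face_last (Qcoord x) j) = Qbase x.
Proof. exact: Qcoord_norm. Qed.

Lemma Qface_mid_subproof i (x : Qpower k.+1) j :
  Qnorm (face_mid (@Qmul _ _ G) i (Qcoord x) j) = Qbase x.
Proof.
by rewrite /face_mid; do 2?case: ifP => _; rewrite ?Qmul_norm ?Qcoord_norm.
Qed.

Definition Qface_first x : Qpower k := Qtuple (Qface_first_subproof x).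
Definition Qface_last x : Qpower k := Qtuple (Qface_last_subproof x).
Definition Qface_mid i x : Qpower k := Qtuple (Qface_mid_subproof i x).

Lemma Qface_first_continuous : continuous Qface_first.
Proof.
apply: Qpower_continuous => [|i]; first exact: Qbase_continuous.
exact: Qcoord_continuous.
Qed.

Lemma Qface_last_continuous : continuous Qface_last.
Proof.
apply: Qpower_continuous => [|i]; first exact: Qbase_continuous.
exact: Qcoord_continuous.
Qed.

Lemma Qface_mid_continuous i : continuous (Qface_mid i).
Proof.
apply: Qpower_continuous => [|j]; first exact: Qbase_continuous.
have -> : (fun x => Qcoord (Qface_mid i x) j) =
  fun x => face_mid (@Qmul _ _ G) i (Qcoord x) j by [].
rewrite /face_mid; case: (j < i)%N; first exact: Qcoord_continuous.
case: (j == i); last exact: Qcoord_continuous.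
apply: Qmul_comp_continuous; [exact: Qcoord_continuous..|].
by move=> s; rewrite !Qcoord_norm.
Qed.

End Faces.
End FibrePower.

Section QCohomology.
Variables (R : realType) (Q : topologicalType) (G : Qgroup R Q).
Variable M : gmodule (hat_pi0 G).

Record qcochain (k : nat) := QCochain {
  qcochain_fun :> Qpower G k -> constQ M Q;
  qcochain_continuous : continuous qcochain_fun;
  qcochain_over : forall x, (qcochain_fun x).2 = Qbase x }.

Definition qval k (a : qcochain k) (x : Qpower G k) : M := (a x).1.

Lemma qcochainP k (a b : qcochain k) : qval a =1 qval b -> a = b.
Proof.
move=> ab; have fE : qcochain_fun a = qcochain_fun b.
  apply/funext => x; apply/eqP/andP; split; apply/eqP; first exact: ab.
  by rewrite !qcochain_over.
case: a b fE {ab} => [f fc fo] [g gc go] /= fg; case: _ / fg in gc go *.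
by rewrite (Prop_irrelevance fc gc) (Prop_irrelevance fo go).
Qed.

Lemma qval_locally_constant k (a : qcochain k) x :
  \forall y \near x, qval a y = qval a x.
Proof.
have ac := @continuous_comp (Qpower G k) (constQ M Q) (discrete_topology M)
  a fst x (@qcochain_continuous k a x) cvg_fst.
exact: (ac _ _ (discrete_set1 ((a x).1 : discrete_topology M))).
Qed.

Lemma qcochain_of_subproof k (f : Qpower G k -> M) :
  (forall x, \forall y \near x, f y = f x) ->
  continuous (fun x => (f x, Qbase x) : constQ M Q).
Proof.
move=> fl x.
have fc : (f : Qpower G k -> discrete_topology M) @ x --> (f x : discrete_topology M).
  by move=> U /nbhs_singleton Ux; apply: filterS (fl x) => y /= ->.
exact: (cvg_pair fc (@Qbase_continuous R Q G k x)).
Qed.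

Definition qcochain_of k (f : Qpower G k -> M)
    (fl : forall x, \forall y \near x, f y = f x) : qcochain k :=
  QCochain (qcochain_of_subproof fl) (fun=> erefl).

HB.instance Definition _ k := gen_eqMixin (qcochain k).
HB.instance Definition _ k := gen_choiceMixin (qcochain k).

Lemma qzero_subproof k (x : Qpower G k) : \forall y \near x, 0 = 0 :> M.
Proof. exact: filterE. Qed.

Lemma qopp_subproof k (a : qcochain k) x :
  \forall y \near x, - qval a y = - qval a x.
Proof. by apply: filterS (qval_locally_constant a x) => y ->. Qed.

Lemma qadd_subproof k (a b : qcochain k) x :
  \forall y \near x, qval a y + qval b y = qval a x + qval b x.
Proof.
by apply: filterS2 (qval_locally_constant a x) (qval_locally_constant b x)
  => y -> ->.
Qed.

Definition qzero k : qcochain k := qcochain_of (@qzero_subproof k).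
Definition qopp k (a : qcochain k) := qcochain_of (qopp_subproof a).
Definition qadd k (a b : qcochain k) := qcochain_of (qadd_subproof a b).

Lemma qaddA k : associative (@qadd k).
Proof. by move=> a b c; apply: qcochainP => x; exact: addrA. Qed.
Lemma qaddC k : commutative (@qadd k).
Proof. by move=> a b; apply: qcochainP => x; exact: addrC. Qed.
Lemma qadd0 k : left_id (@qzero k) (@qadd k).
Proof. by move=> a; apply: qcochainP => x; exact: add0r. Qed.
Lemma qaddN k : left_inverse (@qzero k) (@qopp k) (@qadd k).
Proof. by move=> a; apply: qcochainP => x; exact: addNr. Qed.
HB.instance Definition _ k := GRing.isZmodule.Build (qcochain k)
  (@qaddA k) (@qaddC k) (@qadd0 k) (@qaddN k).

(* Continuity into the discrete factor of [M_Q] is local constancy of [qval],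
   and the fibrewise law of [M_Q] is the addition of [M] on [qval]. *)
Definition qdiff_val k (a : qcochain k) (x : Qpower G k.+1) : M :=
  (actQ (Qcoord x ord0) (a (Qface_first x))).1
  + \sum_(i < k) qval a (Qface_mid i x) *~ (-1) ^+ i.+1
  + qval a (Qface_last x) *~ (-1) ^+ k.+1.

Lemma qdiff_subproof k (a : qcochain k) x :
  \forall y \near x, qdiff_val a y = qdiff_val a x.
Proof.
have firstx : \forall y \near x, qval a (Qface_first y) = qval a (Qface_first x).
  exact: (@Qface_first_continuous _ _ G k x _ (qval_locally_constant a _)).
have lastx : \forall y \near x, qval a (Qface_last y) = qval a (Qface_last x).
  exact: (@Qface_last_continuous _ _ G k x _ (qval_locally_constant a _)).
have etax : \forall y \near x, eta (Qcoord y ord0) = eta (Qcoord x ord0).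
  exact: (@Qcoord_continuous _ _ G _ ord0 x _ (eta_locally_constant _)).
have midx : \forall y \near x, forall i : 'I_k,
    qval a (Qface_mid i y) = qval a (Qface_mid i x).
  apply: (@filter_forall _ _ _ (nbhs x)) => i.
  exact: (@Qface_mid_continuous _ _ G k i x _ (qval_locally_constant a _)).
near=> y; rewrite /qdiff_val /actQ /= -!/(qval _ _).
have -> : eta (Qcoord y ord0) = eta (Qcoord x ord0) by near: y.
have -> : qval a (Qface_first y) = qval a (Qface_first x) by near: y.
have -> : qval a (Qface_last y) = qval a (Qface_last x) by near: y.
have ym : forall i : 'I_k, qval a (Qface_mid i y) = qval a (Qface_mid i x).
  by near: y.
by congr (_ + _ + _); apply: eq_bigr => i _; rewrite ym.
Unshelve. all: by end_near. Qed.

Definition qdiff_fun k (a : qcochain k) : qcochain k.+1 :=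
  qcochain_of (qdiff_subproof a).

Lemma qdiff_additive k : zmod_morphism (@qdiff_fun k).
Proof.
move=> a b; apply: qcochainP => x.
have E : forall y, qval (a - b) y = qval a y - qval b y by [].
change (qdiff_val (a - b) x = qdiff_val a x - qdiff_val b x).
rewrite /qdiff_val /actQ /= -!/(qval _ _) !E raddfB mulrzBl.
rewrite (eq_bigr (fun i : 'I_k => qval a (Qface_mid i x) *~ (-1) ^+ i.+1
  - qval b (Qface_mid i x) *~ (-1) ^+ i.+1)) => [|i _]; last by rewrite E mulrzBl.
by rewrite sumrB !opprD [in RHS]addrACA (addrACA (gact M _ _)).
Qed.
HB.instance Definition _ k :=
  GRing.isZmodMorphism.Build _ _ (@qdiff_fun k) (@qdiff_additive k).

Definition qcochains : cochains :=
  {| cochain := qcochain; codiff := fun k => @qdiff_fun k |}.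

Definition eta_pull_val k (a : gcochain M k) (x : Qpower G k) : M :=
  a (fun i => eta (Qcoord x i)).

Lemma eta_pull_subproof k (a : gcochain M k) x :
  \forall y \near x, eta_pull_val a y = eta_pull_val a x.
Proof.
have etax : \forall y \near x, forall i : 'I_k,
    eta (Qcoord y i) = eta (Qcoord x i).
  apply: (@filter_forall _ _ _ (nbhs x)) => i.
  exact: (@Qcoord_continuous _ _ G _ i x _ (eta_locally_constant _)).
by apply: filterS etax => y yx; congr a; apply/funext.
Qed.

Definition eta_pull_fun k (a : gcochain M k) : qcochain k :=
  qcochain_of (eta_pull_subproof a).

Lemma eta_pull_additive k : zmod_morphism (@eta_pull_fun k).
Proof. by move=> a b; apply: qcochainP. Qed.
HB.instance Definition _ k := GRing.isZmodMorphism.Build _ _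
  (@eta_pull_fun k) (@eta_pull_additive k).

Definition eta_pull k : {additive gcochains M k -> qcochains k} :=
  @eta_pull_fun k.

Lemma eta_pull_diff k (a : gcochains M k) :
  codiff qcochains k (eta_pull k a) = eta_pull k.+1 (codiff (gcochains M) k a).
Proof.
apply: qcochainP => x; rewrite /qval /= /qdiff_val /eta_pull_val /gdiff_fun.
congr (_ + _ + _); apply: eq_bigr => i _; congr (_ *~ _); congr a.
apply/funext => j; rewrite /Qface_mid /Qcoord /= /face_mid.
by do 2?case: ifP => //; rewrite etaM// !Qcoord_norm.
Qed.

Definition eta_star k :
    {additive cohomology (gcochains M) k -> cohomology qcochains k} :=
  cohomology_map eta_pull_diff k.

End QCohomology.

(* Main.v *)
Require Import Defs.
From mathcomp Require Import all_boot all_order all_algebra.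
From mathcomp Require Import all_classical all_reals all_analysis.

(** The map [eta] is constant on connected components, and crossed
    homomorphisms out of a presented group are exactly the families of values
    on the generators whose Fox extension kills the relators.  These two facts
    match the 1-cocycles on both sides, already before passing to cohomology.

    A 1-cocycle of [G] is a locally constant [b] with
    [b (g h) = b g + eta g . b h] for [g], [h] in one fibre.  Being locally
    constant, it is a function on [pi0 G], that is, on the generators of
    [hat_pi0 G]; and a relator [c1 c2 c3^-1] comes from some [g] in [c1] and
    [h] in [c2] with [g h] in [c3], so that the cocycle identity at [(g, h)]
    is precisely the vanishing of the Fox extension on that relator
    ([crossed_hom_of_gens]).  So [b] is the pullback of a cocycle of
    [hat_pi0 G], whence surjectivity.

    For injectivity, suppose that the pullback of a cocycle [a] is the
    coboundary of a section of [M_Q].  Such a section is a locally constant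
    function on the connected space [Q], hence a constant [m], and [a] agrees
    with the principal crossed homomorphism of [m] on the generators [eta g].
    A crossed homomorphism is determined by its values on generators
    ([crossed_hom_gens_eq0]), so [a] is a coboundary. *)

Set Implicit Arguments.
Unset Strict Implicit.
Unset Printing Implicit Defensive.

Import Order.TTheory GRing.Theory Num.Theory.

Local Open Scope classical_set_scope.
Local Open Scope ring_scope.
Local Open Scope quotient_scope.

(** * Crossed homomorphisms on a presented group *)

Definition crossed_hom (Gamma : groupType) (M : gmodule Gamma)
    (D : Gamma -> M) : Prop :=
  forall x y, D (x * y)%g = D x + gact M x (D y).

Lemma crossed_homB (Gamma : groupType) (M : gmodule Gamma) (D E : Gamma -> M) :
  crossed_hom D -> crossed_hom E -> crossed_hom (fun x => D x - E x).
Proof. by move=> DM EM x y; rewrite DM EM raddfB opprD addrACA. Qed.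

Lemma principal_crossed_hom (Gamma : groupType) (M : gmodule Gamma) (m : M) :
  crossed_hom (fun x => gact M x m - m).
Proof. by move=> x y; rewrite gactM raddfB [RHS]addrC addrA subrK. Qed.

Section CrossedHomPresented.
Variables (X : choiceType) (rels : set (seq (X * bool))).
Variable M : gmodule (presented rels).

Local Notation cls u := (\pi_(presented rels) (u : word X)).

Lemma cls_cat (u v : word X) : cls (u ++ v) = (cls u * cls v)%g.
Proof.
apply/esym/presented_eqP.
exact: word_cat (word_cong_repr _ _) (word_cong_repr _ _).
Qed.

Lemma cls_cancel x b : (cls [:: (x, b)] * cls [:: (x, ~~ b)])%g = 1%g.
Proof. by rewrite -cls_cat; apply/presented_eqP/word_cancel. Qed.

Lemma crossed_hom1 (D : presented rels -> M) : crossed_hom D -> D 1%g = 0.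
Proof.
move=> /(_ 1%g 1%g); rewrite mulg1 gact1 => /eqP.
by rewrite -subr_eq subrr eq_sym => /eqP.
Qed.

(** A crossed homomorphism kills the inverse of any element that it kills, so
    its zeros form a subgroup. *)
Lemma crossed_hom_gens_eq0 (D : presented rels -> M) :
  crossed_hom D -> (forall x, D (pres_gen rels x) = 0) -> forall a, D a = 0.
Proof.
move=> DM D0 a; rewrite -[a]reprK.
elim: (repr a : word X) => [|[x b] u IHu]; first exact: crossed_hom1.
rewrite -cat1s cls_cat DM IHu raddf0 addr0.
case: b; first exact: D0.
have := DM (cls [:: (x, false)]) (cls [:: (x, ~~ false)]).
by rewrite cls_cancel crossed_hom1// D0 raddf0 addr0.
Qed.

Variable b : X -> M.

(** The value on [x^-1] is forced by that on [x], because a crossed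
    homomorphism vanishes at [x^-1 x]. *)
Definition fox_letter (l : X * bool) : M :=
  if l.2 then b l.1 else - gact M (cls [:: l]) (b l.1).

Definition fox (u : word X) : M :=
  foldr (fun l m => fox_letter l + gact M (cls [:: l]) m) 0 u.

Lemma fox_cat (u v : word X) : fox (u ++ v) = fox u + gact M (cls u) (fox v).
Proof.
elim: u => [|l u IHu] /=; first by rewrite add0r (_ : cls [::] = 1%g) // gact1.
by rewrite IHu raddfD -[l :: u]cat1s cls_cat gactM addrA.
Qed.

Lemma fox_cong (u v : word X) :
  (forall r, rels r -> fox r = 0) -> word_cong rels u v -> fox u = fox v.
Proof.
move=> rel0; elim=> {u v} [||u v w _ -> _ ->|u u' v v' uu' IHu _ IHv|x e|r] //.
- by rewrite !fox_cat IHu IHv; have /presented_eqP -> := uu'.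
- rewrite /= raddf0 addr0; have := cls_cancel x e.
  rewrite /fox_letter; case: e => /= xx; last by rewrite addNr.
  by rewrite raddfN -gactM xx gact1 subrr.
- exact: rel0.
Qed.

(** The shape of the relators of [hat_pi0]: for them the condition of
    [crossed_hom_of_gens] below is the 1-cocycle identity. *)
Lemma fox_triangle x y z : rels [:: (x, true); (y, true); (z, false)] ->
  fox [:: (x, true); (y, true); (z, false)] =
  b x + gact M (pres_gen rels x) (b y) - b z.
Proof.
move=> rxyz; have rel1 :
    (cls [:: (x, true)] * cls [:: (y, true)] * cls [:: (z, false)])%g = 1%g.
  rewrite -(cls_cat [:: _] [:: _]) -(cls_cat (_ ++ _) [:: _]).
  exact/presented_eqP/word_rel.
rewrite /= /fox_letter /= !raddf0 addr0 raddfD !raddfN.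
by rewrite -!gactM rel1 gact1 addrA.
Qed.

(** Equivalently, [x |-> (b x, x)] extends to a homomorphism into the
    semidirect product of [M] by the presented group. *)
Lemma crossed_hom_of_gens : (forall r, rels r -> fox r = 0) ->
  exists2 D : presented rels -> M,
    crossed_hom D & forall x, D (pres_gen rels x) = b x.
Proof.
move=> rel0; exists (fun a => fox (repr a)) => [x y|x].
  rewrite (fox_cong rel0 (word_cong_repr rels (repr x ++ repr y))).
  by rewrite fox_cat reprK.
rewrite (fox_cong rel0 (word_cong_repr rels [:: (x, true)])).
by rewrite /= raddf0 addr0.
Qed.

End CrossedHomPresented.

(** * Cochains in degrees 0 and 1 *)

Definition pair2 (T : Type) (x y : T) : 'I_2 -> T :=
  fun i => if i == ord0 then x else y.

Lemma fun_ord1 (T : Type) (u : 'I_1 -> T) : u = (fun=> u ord0).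
Proof. by apply/funext => i; rewrite ord1. Qed.

Lemma fun_ord0 (T : Type) (u v : 'I_0 -> T) : u = v.
Proof. by apply/funext => -[]. Qed.

Section Faces2.
Variables (T : Type) (mul : T -> T -> T) (g : 'I_2 -> T).

Lemma face_first2 : face_first g = (fun=> g ord_max).
Proof.
rewrite [LHS]fun_ord1; apply/funext => _.
by congr g; apply: val_inj.
Qed.

Lemma face_last2 : face_last g = (fun=> g ord0).
Proof.
rewrite [LHS]fun_ord1; apply/funext => _.
by congr g; apply: val_inj.
Qed.

Lemma face_mid2 (i : 'I_1) :
  face_mid mul i g = (fun=> mul (g ord0) (g ord_max)).
Proof.
rewrite [LHS]fun_ord1; apply/funext => _; rewrite ord1 /face_mid ltnn eqxx.
by congr (mul (g _) (g _)); apply: val_inj.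
Qed.

End Faces2.

Section GroupCochains.
Variables (Gamma : groupType) (M : gmodule Gamma).

Lemma gdiff0E (a : gcochain M 0) (m0 : 'I_0 -> Gamma) g :
  gdiff_fun a g = gact M (g ord0) (a m0) - a m0.
Proof.
rewrite /gdiff_fun big_ord0 addr0 expr1 mulrN1z.
by rewrite (fun_ord0 (face_first g) m0) (fun_ord0 (face_last g) m0).
Qed.

Lemma gdiff1E (a : gcochain M 1) g :
  gdiff_fun a g = gact M (g ord0) (a (fun=> g ord_max))
    - a (fun=> (g ord0 * g ord_max)%g) + a (fun=> g ord0).
Proof.
rewrite /gdiff_fun big_ord1 expr1 mulrN1z expr2 mulrNN mulr1 mulr1z.
by rewrite face_first2 face_last2 face_mid2.
Qed.

Lemma gcocycle1P (a : gcochains M 1) :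
  a \in in_ker (codiff (gcochains M) 1) <-> crossed_hom (fun x => a (fun=> x)).
Proof.
have cocycleE (x y z : M) : (x - y + z = 0) <-> (y = z + x).
  split=> [/eqP|->]; last by rewrite addrAC [x + z]addrC subrr.
  by rewrite addrAC subr_eq0 => /eqP <-; rewrite addrC.
split=> [/eqP da x y|aM].
  apply/cocycleE; have := congr1 (fun f => f (pair2 x y)) da.
  by rewrite /= gdiff1E.
by apply/eqP/funext => g; rewrite /= gdiff1E; apply/cocycleE; rewrite aM.
Qed.

End GroupCochains.

Section QCochains.
Variables (R : realType) (Q : topologicalType) (G : Qgroup R Q).

Lemma Qpower_eq k (x y : Qpower G k) :
  Qbase x = Qbase y -> Qcoord x = Qcoord y -> x = y.
Proof.
move=> xy1 xy2; apply: val_inj; move: xy1 xy2; rewrite /Qbase /Qcoord.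
by case: (val x) => ? ?; case: (val y) => ? ? /= -> ->.
Qed.

Definition Qsingle (g : G) : Qpower G 1 :=
  @Qtuple R Q G 1 (Qnorm g) (fun=> g) (fun=> erefl).

Lemma Qsingle_coord (x : Qpower G 1) : Qsingle (Qcoord x ord0) = x.
Proof.
apply: Qpower_eq; first exact: Qcoord_norm.
by rewrite [RHS]fun_ord1.
Qed.

Lemma Qsingle_continuous : continuous Qsingle.
Proof.
apply: Qpower_continuous => [|i]; first exact: Qnorm_continuous.
by move=> g; exact: cvg_id.
Qed.

(** The fibre product of no factors is [Q]; the constant tuple below has no
    entries. *)
Definition Qpoint (q : Q) : Qpower G 0 :=
  @Qtuple R Q G 0 q (fun=> Qone G q) (fun=> Qone_norm G q).

Lemma Qpoint_base (x : Qpower G 0) : Qpoint (Qbase x) = x.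
Proof. by apply: Qpower_eq; last exact: fun_ord0. Qed.

Lemma Qpoint_continuous : continuous Qpoint.
Proof.
apply: Qpower_continuous => [|[]//].
by move=> q; exact: cvg_id.
Qed.

Lemma Qpair_subproof (g h : G) : Qnorm g = Qnorm h ->
  forall i, Qnorm (pair2 g h i) = Qnorm g.
Proof. by move=> gh i; rewrite /pair2; case: ifP. Qed.

Variable M : gmodule (hat_pi0 G).

Definition qval1 (a : qcochain M 1) (g : G) : M := qval a (Qsingle g).

Lemma qcochain1P (a b : qcochain M 1) : qval1 a =1 qval1 b -> a = b.
Proof. by move=> ab; apply: qcochainP => x; rewrite -(Qsingle_coord x); exact: ab. Qed.

Lemma qval1_locally_constant (a : qcochain M 1) g :
  \forall h \near g, qval1 a h = qval1 a g.
Proof. exact: (@Qsingle_continuous g _ (qval_locally_constant a _)). Qed.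

Lemma qval1_eta_pull (a : gcochain M 1) g :
  qval1 (eta_pull_fun a) g = a (fun=> eta g).
Proof. by []. Qed.

Lemma qdiff0E (a : qcochain M 0) g : qval1 (qdiff_fun a) g =
  gact M (eta g) (qval a (Qpoint (Qnorm g))) - qval a (Qpoint (Qnorm g)).
Proof.
rewrite /qval1 /qval /= /qdiff_val /actQ /= -!/(qval _ _).
rewrite big_ord0 addr0 expr1 mulrN1z.
by rewrite -(Qpoint_base (Qface_first _)) -(Qpoint_base (Qface_last _)).
Qed.

Lemma qdiff1E (a : qcochain M 1) (x : Qpower G 2) :
  let g := Qcoord x ord0 in let h := Qcoord x ord_max in
  qval (qdiff_fun a) x =
    gact M (eta g) (qval1 a h) - qval1 a (Qmul g h) + qval1 a g.
Proof.
rewrite /qval /= /qdiff_val /actQ /= -!/(qval _ _).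
rewrite big_ord1 expr1 mulrN1z expr2 mulrNN mulr1 mulr1z /qval1.
congr (gact M _ (qval a _) - qval a _ + qval a _);
  rewrite -[LHS]Qsingle_coord; congr Qsingle; rewrite /Qcoord /=.
- by rewrite face_first2.
- by rewrite face_mid2.
- by rewrite face_last2.
Qed.

Lemma qcocycle1M (a : qcochains M 1) :
  a \in in_ker (codiff (qcochains M) 1) -> forall g h, Qnorm g = Qnorm h ->
  qval1 a (Qmul g h) = qval1 a g + gact M (eta g) (qval1 a h).
Proof.
move=> /eqP da g h gh.
have := congr1 (fun f => qval f (Qtuple (Qpair_subproof gh))) da.
rewrite [LHS]qdiff1E /Qcoord /= => /eqP.
by rewrite addrAC subr_eq0 => /eqP <-; rewrite addrC.
Qed.

End QCochains.

(** * Locally constant functions and connectedness *)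

(** The fibres of a locally constant function are open and closed. *)
Lemma locally_constant_connected (T : topologicalType) (S : Type) (f : T -> S)
    (A : set T) (x y : T) :
  (forall t, \forall s \near t, f s = f t) ->
  connected A -> A x -> A y -> f x = f y.
Proof.
move=> fl Ac Ax Ay; pose C := [set t | f t = f x].
have oC : open C.
  by rewrite openE => t ft; apply: filterS (fl t) => s fs; rewrite /C /= fs.
have cC : closed C.
  rewrite -openC openE => t nft.
  by apply: filterS (fl t) => s /= fs fsx; apply: nft; rewrite /C /= -fs.
have AIC : A `&` C = A.
  apply: Ac; first by exists x.
  - by exists C.
  - by exists C.
by have [_ /= ->] : (A `&` C) y by rewrite AIC.
Qed.

Lemma pi0_class_eqP (X : topologicalType) (x y : X) :
  pi0_class x = pi0_class y <-> connected_component [set: X] x y.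
Proof.
split=> [/(congr1 val) /= ->|xy]; first exact: connected_component_refl.
by apply: val_inj => /=; exact: same_connected_component.
Qed.

Lemma pi0_classP (X : topologicalType) (c : pi0 X) :
  exists x, pi0_class x = c.
Proof.
by case: c => A Ac; have [x _ xA] := set_mem Ac; exists x; apply: val_inj.
Qed.

(** Components are merely closed in general, but a locally constant function is
    constant on each of them since they are connected. *)
Lemma pi0_locally_constant (X : topologicalType) (S : Type) (f : X -> S) :
  (forall t, \forall s \near t, f s = f t) ->
  exists b : pi0 X -> S, forall x, b (pi0_class x) = f x.
Proof.
move=> fl; have [r rK] := choice (@pi0_classP X).
exists (f \o r) => x /=; have /pi0_class_eqP[A [Ar _ Ac] Ax] := rK (pi0_class x).
exact: locally_constant_connected Ac Ar Ax.
Qed.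

(** * Comparison in degree 1 *)

Lemma cohomology_class_eq0 (C : cochains) k (z : cocycle C k) :
  cohomology_class z = 0 <-> z \in @coboundary C k.
Proof.
rewrite -[X in _ = X](raddf0 (\pi_(Quotient.quot (@coboundary C k)))).
by rewrite -[X in X \in _]subr0; exact: cohomology_class_eqP.
Qed.

Section Comparison.
Variables (R : realType) (Q : topologicalType) (G : Qgroup R Q).
Variable M : gmodule (hat_pi0 G).

(** A cocycle descends to [pi0 G], and its values there satisfy the relator
    conditions because each relator is witnessed by one product in [G]. *)
Lemma eta_star1_surj (y : cohomology (qcochains M) 1) :
  exists x, eta_star M 1 x = y.
Proof.
pose z := repr y; have zM := qcocycle1M (ker_valP z).
have [b bE] := pi0_locally_constant (qval1_locally_constant (ker_val z)).
have rel0 r : @hat_pi0_relators R Q G r -> @fox _ _ M b r = 0.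
  move=> [c1 [c2 [c3 [[k [c3k [g [h [c1g c2h gh kE]]]]] ->]]]].
  have memE (c : pi0 G) x : val c x -> c = pi0_class x.
    by have [x0 <-] := pi0_classP c; move=> /pi0_class_eqP.
  rewrite (memE _ _ c1g) (memE _ _ c2h) (memE _ _ c3k).
  rewrite fox_triangle; first by rewrite !bE kE zM// subrr.
  exists (pi0_class g), (pi0_class h), (pi0_class k); split=> //.
  exists k; split; first exact: connected_component_refl.
  by exists g, h; split=> //; exact: connected_component_refl.
have [D DM DE] := crossed_hom_of_gens rel0.
pose a : gcochains M 1 := fun u => D (u ord0).
have aker : a \in in_ker (codiff (gcochains M) 1) by exact/gcocycle1P.
exists (cohomology_class (Ker aker)).
rewrite [LHS]cohomology_mapE -[RHS]reprK; congr (\pi _).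
apply: val_inj; apply: qcochain1P => g /=.
by rewrite qval1_eta_pull /a DE bE.
Qed.

(** The bounding section is locally constant on the connected space [Q], hence
    a constant [c]; the given cocycle minus the principal crossed homomorphism
    of [c] then vanishes on the generators. *)
Lemma eta_star1_inj : connected [set: Q] -> injective (eta_star M 1).
Proof.
move=> Qc; apply: raddf_inj => x; rewrite -[x]reprK; set z : cocycle _ _ := repr x.
have zM := (gcocycle1P _).1 (ker_valP z).
rewrite [X in X = _ -> _]cohomology_mapE.
move=> /cohomology_class_eq0/asboolP[m /= mE].
apply/cohomology_class_eq0/asboolP.
have [c cE] : exists c : M, forall q, qval m (Qpoint G q) = c.
  (* Over an empty base every section is constant with any value. *)
  have [[q0 _]|Q0] := pselect (exists q0 : Q, True); last first.
    by exists 0 => q; case: Q0; exists q.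
  exists (qval m (Qpoint G q0)) => q.
  apply: (locally_constant_connected
    (f := fun q => qval m (Qpoint G q)) _ Qc) => // t.
  exact: (@Qpoint_continuous _ _ G t _ (qval_locally_constant m _)).
pose D x := ker_val z (fun=> x) - (gact M x c - c).
have DM : crossed_hom D := crossed_homB zM (principal_crossed_hom c).
have D0 : forall k, D (pres_gen _ k) = 0.
  move=> k; have [g <-] := pi0_classP k.
  rewrite /D -/(eta g) -(qval1_eta_pull (ker_val z)).
  by rewrite [X in qval1 X]mE [X in X - _]qdiff0E cE subrr.
exists (fun=> c); apply/funext => u.
rewrite /= (gdiff0E _ (fun=> 1%g)) [u in LHS]fun_ord1; apply/eqP.
by rewrite -subr_eq0; apply/eqP; exact: crossed_hom_gens_eq0 DM D0 _.
Qed.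

End Comparison.

Theorem lemma1p30 (R : realType) (Q : topologicalType)
    (Q_hausdorff : hausdorff_space Q) (Q_connected : connected [set: Q])
    (Q_lpc : locally_path_connected R Q)
    (G : Qgroup R Q) (M : gmodule (hat_pi0 G)) :
  bijective (eta_star M 1).
Proof.
have [g gK] := choice (@eta_star1_surj R Q G M).
by exists g => // x; apply: eta_star1_inj => //; rewrite gK.
Qed.
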